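(* Let $\mathcal{S}_1$ and $\mathcal{S}_2$ be two subsets of $\mathcal{D}=\{1,\dots,d\}$. If $\mathcal{S}_1$ is a proper subset of $\mathcal{S}_2$, $|\mathcal{S}_2|\le n$, $\mathbf{X}_{\mathcal{S}_2}$ has full column rank, and $\boldsymbol\Sigma_{\mathcal{S}_2}$ is positive definite, then $$\mathrm{df}_{\rm R}(\mathcal{S}_1)<\mathrm{df}_{\rm R}(\mathcal{S}_2).$$
   Context: Let $\mathbf{X}\in\mathbb{R}^{n\times d}$ be a design matrix whose rows $\mathbf{x}_i^\top$ are i.i.d. with mean $\mathbf{0}$ and covariance matrix $\boldsymbol\Sigma\in\mathbb{R}^{d\times d}$. For $\mathcal{S}\subseteq\{1,\dots,d\}$ with $|\mathcal{S}|=p$, $\mathbf{X}_{\mathcal{S}}\in\mathbb{R}^{n\times p}$ is the submatrix of the columns of $\mathbf{X}$ indexed by $\mathcal{S}$ and $\boldsymbol\Sigma_{\mathcal{S}}$ is the corresponding $p\times p$ principal submatrix of $\boldsymbol\Sigma$. For $p\le n$ and $\mathbf{X}_{\mathcal{S}}$ of full column rank, the predictive model degrees of freedom (given $\mathbf{X}$) of the ordinary least squares regression on the variables in $\mathcal{S}$ is $$\mathrm{df}_{\rm R}(\mathcal{S})=\frac p2+\frac n2\,\mathrm{tr}\big[(\mathbf{X}_{\mathcal{S}}^\top\mathbf{X}_{\mathcal{S}})^{-1}\boldsymbol\Sigma_{\mathcal{S}}\big]$$ (with value $0$ for $\mathcal{S}=\emptyset$). *)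

(* Defs.v *)
From mathcomp Require Import all_boot all_order all_algebra.
From mathcomp Require Import all_classical all_reals all_analysis.

Set Implicit Arguments.
Unset Strict Implicit.
Unset Printing Implicit Defensive.

Import Order.TTheory GRing.Theory Num.Theory.

Local Open Scope classical_set_scope.
Local Open Scope ring_scope.

(* The columns are listed in the order of [enum S]. *)
Definition cols_of (R : Type) (n d : nat) (X : 'M[R]_(n, d)) (S : {set 'I_d})
    : 'M[R]_(n, #|S|) :=
  colsub enum_val X.

Definition principal_submx (R : Type) (d : nat) (Sigma : 'M[R]_d)
    (S : {set 'I_d}) : 'M[R]_#|S| :=
  mxsub enum_val enum_val Sigma.

Definition full_column_rank (F : fieldType) (n p : nat) (A : 'M[F]_(n, p)) : Prop :=
  \rank A = p.

Definition posdefmx (R : realFieldType) (p : nat) (A : 'M[R]_p) : Prop :=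
  A^T = A /\ forall v : 'cV[R]_p, v != 0 -> 0 < (v^T *m A *m v) 0 0.

Definition random_row (T R : Type) (n d : nat) (X : T -> 'M[R]_(n, d))
    (i : 'I_n) (w : T) : d.-tuple R :=
  [tuple X w i j | j < d].

Definition mutually_independent (d d' : measure_display) (T : measurableType d)
    (T' : measurableType d') (R : realType) (P : probability T R)
    (I : finType) (Y : I -> T -> T') : Prop :=
  forall (J : {set I}) (B : I -> set T'), (forall i, measurable (B i)) ->
    P [set w | forall i, i \in J -> B i (Y i w)] =
    (\prod_(i in J) P (Y i @^-1` B i))%E.

Definition identically_distributed (d d' : measure_display)
    (T : measurableType d) (T' : measurableType d') (R : realType)
    (P : probability T R) (I : Type) (Y : I -> T -> T') : Prop :=
  forall (i k : I) (B : set T'), measurable B ->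
    P (Y i @^-1` B) = P (Y k @^-1` B).

(* Square integrability (which includes measurability of the entries) is what
   makes the mean and the covariance matrix of the rows well defined. *)
Record iid_centered_design (disp : measure_display) (T : measurableType disp)
    (R : realType) (P : probability T R) (n d : nat)
    (X : T -> 'M[R]_(n, d)) (Sigma : 'M[R]_d) : Prop := IidCenteredDesign {
  design_L2 : forall i j, (fun w => X w i j) \in Lfun P 2%:E;
  design_indep : mutually_independent P (random_row X);
  design_ident : identically_distributed P (random_row X);
  design_mean : forall i j, 'E_P[fun w => X w i j]%E = 0%E;
  design_cov : forall i j k,
    covariance P (fun w => X w i j) (fun w => X w i k) = (Sigma j k)%:E }.

(* For [S = set0] the matrices are 0 x 0, so the value is 0.  The formula is
   meaningful when [cols_of X S] has full column rank; otherwise [invmx]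
   returns its argument unchanged. *)
Definition dfR (R : realType) (n d : nat) (X : 'M[R]_(n, d))
    (Sigma : 'M[R]_d) (S : {set 'I_d}) : R :=
  let XS := cols_of X S in
  #|S|%:R / 2 +
  n%:R / 2 * \tr (invmx (XS^T *m XS) *m principal_submx Sigma S).

(* Main.v *)
(** Write [A] for the larger design, [G = A^T A] for its Gram matrix and [E] for
    the selection matrix such that [A E] is the smaller design.  With
    [K = E (E^T G E)^-1 E^T] one has [K G K = K], so [D = G^-1 - K] satisfies
    [D = D G D = (A D)^T (A D)].  The traces of the two models differ by
    [tr (D Sigma) = tr ((A D) Sigma (A D)^T)], which is nonnegative, and the
    term [p / 2] makes the inequality strict. *)
Require Import Defs.
From mathcomp Require Import all_boot all_order all_algebra.
From mathcomp Require Import all_classical all_reals all_analysis.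

Import Order.TTheory GRing.Theory Num.Theory.

Local Open Scope ring_scope.

(** Each diagonal entry of [B *m B^T] is the sum of the squares of a row of [B]. *)
Lemma gram_row_eq0 (R : realFieldType) (m n : nat) (B : 'M[R]_(m, n)) :
  (B *m B^T == 0) = (B == 0).
Proof.
apply/eqP/eqP => [BB0|->]; last by rewrite mul0mx.
apply/matrixP => i j; rewrite mxE.
have /eqP := congr1 (fun C : 'M[R]_m => C i i) BB0.
rewrite !mxE psumr_eq0; last by move=> k _; rewrite mxE -expr2 sqr_ge0.
move/allP/(_ j (mem_index_enum j)); rewrite mxE -expr2 sqrf_eq0.
by move/eqP.
Qed.

(** If [v A^T A = 0], then [v A^T] times its transpose is [0], so [v A^T = 0], and [v = 0] because
    [A^T] is row free. *)
Lemma unitmx_gram (R : realFieldType) (n p : nat) (A : 'M[R]_(n, p)) :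
  \rank A = p -> A^T *m A \in unitmx.
Proof.
move=> rkA; have freeA : row_free A^T by rewrite /row_free mxrank_tr rkA.
rewrite -row_free_unit; apply: inj_row_free => v vG0; apply/eqP.
rewrite -(mulmx_free_eq0 _ freeA) -gram_row_eq0 trmx_mul trmxK.
by rewrite -mulmxA (mulmxA A^T) mulmxA vG0 mul0mx.
Qed.

(** The diagonal entries are the values of the quadratic form of [S] at the rows of [B]; a zero row
    contributes [0]. *)
Lemma mxtrace_conj_ge0 (R : realFieldType) (n p : nat) (B : 'M[R]_(n, p))
    (S : 'M[R]_p) :
  posdefmx S -> 0 <= \tr (B *m S *m B^T).
Proof.
move=> [_ Spos]; apply: sumr_ge0 => i _.
have -> : (B *m S *m B^T) i i = ((row i B)^T^T *m S *m (row i B)^T) 0 0.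
  rewrite trmxK -row_mul !mxE; apply: eq_bigr => k _; by rewrite !mxE.
have [->|nz] := eqVneq (row i B)^T 0; first by rewrite mulmx0 mxE.
exact/ltW/Spos.
Qed.

(** Selecting columns by an injection [f] keeps the enumerations of the index sets out of the
    algebra. *)
Lemma le_mxtrace_gram_colsub (R : realFieldType) (n p q : nat)
    (A : 'M[R]_(n, p)) (S : 'M[R]_p) (f : 'I_q -> 'I_p) :
  injective f -> \rank A = p -> posdefmx S ->
  \tr (invmx ((colsub f A)^T *m colsub f A) *m mxsub f f S) <=
  \tr (invmx (A^T *m A) *m S).
Proof.
move=> f_inj rkA Spos.
pose E : 'M[R]_(p, q) := colsub f 1%:M.
have AE : colsub f A = A *m E by rewrite mulmx_colsub mulmx1.
have SE : mxsub f f S = E^T *m S *m E.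
  rewrite mulmx_colsub mulmx1 trmx_mxsub trmx1 mul_rowsub_mx mul1mx.
  by apply/matrixP => i j; rewrite !mxE.
have EE : E^T *m E = 1%:M.
  rewrite mulmx_colsub mulmx1 trmx_mxsub trmx1.
  by apply/matrixP => i j; rewrite !mxE (inj_eq f_inj).
have uG := unitmx_gram _ _ _ _ rkA.
(* [A *m E] has full column rank: [v E^T A^T = 0] gives [v E^T = 0], and multiplying by [E] on the
   right gives [v = 0]. *)
have uG1 : (A *m E)^T *m (A *m E) \in unitmx.
  apply: unitmx_gram; rewrite -mxrank_tr trmx_mul; apply/eqP.
  rewrite -[_ == _]/(row_free _); apply: inj_row_free => v.
  rewrite mulmxA => /eqP; rewrite mulmx_free_eq0; last first.
    by rewrite /row_free mxrank_tr rkA.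
  by move/eqP/(congr1 (mulmx^~ E)); rewrite -mulmxA EE mulmx1 mul0mx.
rewrite AE SE; set G := A^T *m A in uG *; set H := _ *m _ in uG1 *.
have HE : H = E^T *m G *m E by rewrite /H trmx_mul !mulmxA.
have symG : G^T = G by rewrite trmx_mul trmxK.
have symH : H^T = H by rewrite trmx_mul trmxK.
pose K := E *m invmx H *m E^T; pose D := invmx G - K.
have KGK : K *m G *m K = K.
  have -> : K *m G *m K =
      E *m (invmx H *m (E^T *m G *m E)) *m invmx H *m E^T.
    by rewrite /K !mulmxA.
  by rewrite -HE mulVmx // mulmx1.
have symD : D^T = D.
  by rewrite /D /K linearB /= !trmx_mul trmxK !trmx_inv symG symH mulmxA.
(* [K G D = K G G^-1 - K G K = K - K = 0], hence [D G D = D - K G D = D]. *)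
have DGD : D = (A *m D)^T *m (A *m D).
  rewrite trmx_mul symD mulmxA -(mulmxA D) -/G {2}/D mulmxBl mulVmx //.
  rewrite mulmxBl mul1mx /D mulmxBr KGK mulmxK //.
  by rewrite subrr subr0.
have -> : \tr (invmx H *m (E^T *m S *m E)) = \tr (K *m S).
  by rewrite !mulmxA mxtrace_mulC !mulmxA.
rewrite -subr_ge0 -raddfB /= -mulmxBl -/D DGD -mulmxA mxtrace_mulC.
exact: mxtrace_conj_ge0.
Qed.

Theorem theorem4p1 (R : realType) (disp : measure_display)
    (T : measurableType disp) (P : probability T R) (n d : nat)
    (X : T -> 'M[R]_(n, d)) (Sigma : 'M[R]_d)
    (hX : iid_centered_design P X Sigma)
    (w : T) (S1 S2 : {set 'I_d})
    (hS : S1 \proper S2) (hn : (#|S2| <= n)%N)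
    (hrank : full_column_rank (cols_of (X w) S2))
    (hpos : posdefmx (principal_submx Sigma S2)) :
  dfR (X w) Sigma S1 < dfR (X w) Sigma S2.
Proof.
have [sS [x0 x0S2 _]] := properP hS.
(* [f] sends the position of an element in [enum S1] to its position in [enum S2]; [x0] only
   witnesses that [S2] is nonempty. *)
pose f (i : 'I_#|S1|) : 'I_#|S2| := enum_rank_in x0S2 (enum_val i).
have fK i : enum_val (f i) = enum_val i.
  by apply: enum_rankK_in; apply: (fintype.subsetP sS); apply: enum_valP.
have f_inj : injective f.
  by move=> i j fij; apply: enum_val_inj; rewrite -!fK fij.
have colsS1 : cols_of (X w) S1 = colsub f (cols_of (X w) S2).
  by apply/matrixP => i j; rewrite !mxE fK.
have SigmaS1 : principal_submx Sigma S1 = mxsub f f (principal_submx Sigma S2).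
  by apply/matrixP => i j; rewrite !mxE !fK.
rewrite /dfR colsS1 SigmaS1; apply: ltr_leD.
  by rewrite ltr_pM2r ?invr_gt0 ?ltr0n // ltr_nat proper_card.
apply: ler_wpM2l; first by rewrite divr_ge0 ?ler0n.
exact: le_mxtrace_gram_colsub.
Qed.
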